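(* Let $\mathcal{C}$ be a connected loop-free category, let $A$, $B$ be index sets, and let $\Psi_A : \mathcal{C} \to \prod_{\alpha\in A} X_\alpha$ and $\Psi_B : \mathcal{C}\to\prod_{\beta\in B} Y_\beta$ be two decompositions of $\mathcal{C}$. Then there exist a family of loop-free categories $(Z_{\alpha,\beta})_{\alpha\in A,\beta\in B}$ and, for every $\alpha\in A$ and every $\beta\in B$, decompositions (isomorphisms) $$a_\alpha : X_\alpha \to \prod_{\beta\in B} Z_{\alpha,\beta}\qquad\text{and}\qquad b_\beta : Y_\beta\to\prod_{\alpha\in A} Z_{\alpha,\beta}$$ such that $$(b_\beta)_{\beta\in B}\circ(\Psi_B\circ\Psi_A^{-1}) = \gamma\circ (a_\alpha)_{\alpha\in A}$$ as functors $\prod_{\alpha\in A} X_\alpha\to\prod_{\beta\in B}\prod_{\alpha\in A} Z_{\alpha,\beta}$ (equivalently $(b_\beta)_{\beta\in B}\circ\Psi_B=\gamma\circ(a_\alpha)_{\alpha\in A}\circ\Psi_A$), where $\gamma : \prod_{\alpha\in A}\prod_{\beta\in B} Z_{\alpha,\beta}\to\prod_{\beta\in B}\prod_{\alpha\in A} Z_{\alpha,\beta}$ is the natural isomorphism sending $((z_{\alpha,\beta})_{\beta\in B})_{\alpha\in A}$ to $((z_{\alpha,\beta})_{\alpha\in A})_{\beta\in B}$.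
   Context: All categories are small. A category is loop-free if, for every non-identity morphism $f:x\to y$, the hom-set from $y$ to $x$ is empty. A fence of length $n$ is a family of morphisms $(f_i)_{1\le i\le n}$ such that either, for all $i$ for which it makes sense, $\mathrm{cod}(f_{2i})=\mathrm{cod}(f_{2i+1})$ and $\mathrm{dom}(f_{2i-1})=\mathrm{dom}(f_{2i})$; or, for all such $i$, $\mathrm{dom}(f_{2i})=\mathrm{dom}(f_{2i+1})$ and $\mathrm{cod}(f_{2i-1})=\mathrm{cod}(f_{2i})$. A category is connected if any two of its morphisms $f,g$ are joined by a fence with $f_1=f$ and $f_n=g$. A decomposition of a loop-free category $\mathcal{C}$ is an isomorphism of categories from $\mathcal{C}$ to a product $\prod_{\alpha\in A}X_\alpha$ of loop-free categories. For functors $f_\alpha : X_\alpha\to W_\alpha$ ($\alpha\in A$), $(f_\alpha)_{\alpha\in A}:\prod_{\alpha} X_\alpha\to\prod_{\alpha} W_\alpha$ denotes the product functor acting as $f_\alpha$ on the $\alpha$-component. *)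

(* Defs.v *)
From mathcomp Require Import all_boot.
From mathcomp Require Import boolp.

Set Implicit Arguments.
Unset Strict Implicit.
Unset Printing Implicit Defensive.

#[local] Obligation Tactic := try by [].

Record category := Category {
  ob :> Type;
  hom : ob -> ob -> Type;
  cat_id : forall x, hom x x;
  cat_comp : forall x y z, hom y z -> hom x y -> hom x z;
  cat_comp1f : forall x y (f : hom x y), cat_comp (cat_id y) f = f;
  cat_compf1 : forall x y (f : hom x y), cat_comp f (cat_id x) = f;
  cat_compA : forall w x y z (h : hom y z) (g : hom x y) (f : hom w x),
    cat_comp h (cat_comp g f) = cat_comp (cat_comp h g) f }.

Record mor (C : category) := Mor { dom : C; cod : C; arrow : hom dom cod }.

(* Being an identity for an arrow whose two endpoints are not assumed to be
   syntactically the same object. *)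
Inductive is_identity (C : category) : forall x y : C, hom x y -> Prop :=
  IsIdentity (x : C) : is_identity (cat_id x).

Definition loop_free (C : category) : Prop :=
  forall (x y : C) (f : hom x y), ~ is_identity f -> hom y x -> False.

(* The members of the fence are f 1, ..., f n; the other values of f are
   irrelevant. *)
Definition fence (C : category) (n : nat) (f : nat -> mor C) : Prop :=
  (forall i, 0 < i ->
     ((2 * i).+1 <= n -> cod (f (2 * i)) = cod (f (2 * i).+1)) /\
     (2 * i <= n -> dom (f (2 * i).-1) = dom (f (2 * i))))
  \/
  (forall i, 0 < i ->
     ((2 * i).+1 <= n -> dom (f (2 * i)) = dom (f (2 * i).+1)) /\
     (2 * i <= n -> cod (f (2 * i).-1) = cod (f (2 * i)))).

(* The empty category is connected in this sense. *)
Definition connected (C : category) : Prop :=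
  forall f g : mor C, exists n (s : nat -> mor C),
    [/\ 1 <= n, fence n s, s 1 = f & s n = g].

Record functor (C D : category) := Functor {
  fob :> C -> D;
  fhom : forall x y, hom x y -> hom (fob x) (fob y);
  fhom_id : forall x, fhom (cat_id x) = cat_id (fob x);
  fhom_comp : forall x y z (g : hom y z) (f : hom x y),
    fhom (cat_comp g f) = cat_comp (fhom g) (fhom f) }.

Program Definition idF (C : category) : functor C C :=
  {| fob := fun x => x; fhom := fun _ _ f => f |}.

Program Definition compF (C D E : category) (G : functor D E)
    (F : functor C D) : functor C E :=
  {| fob := fun x => G (F x); fhom := fun _ _ f => fhom G (fhom F f) |}.
Next Obligation. by move=> C D E G F x /=; rewrite !fhom_id. Qed.
Next Obligation. by move=> C D E G F x y z g f /=; rewrite !fhom_comp. Qed.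

(* Equality of functors is Leibniz equality: by functional extensionality and
   proof irrelevance, this is equality on objects and on morphisms. *)
Record isomorphism (C D : category) := Isomorphism {
  iso_fun :> functor C D;
  iso_inv : functor D C;
  iso_funK : compF iso_inv iso_fun = idF C;
  iso_invK : compF iso_fun iso_inv = idF D }.

Program Definition prodC (A : Type) (X : A -> category) : category :=
  {| ob := forall a, X a;
     hom := fun x y => forall a, hom (x a) (y a);
     cat_id := fun x a => cat_id (x a);
     cat_comp := fun _ _ _ g f a => cat_comp (g a) (f a) |}.
Next Obligation.
by move=> A X x y f; apply: functional_extensionality_dep => a /=;
  rewrite cat_comp1f.
Qed.
Next Obligation.
by move=> A X x y f; apply: functional_extensionality_dep => a /=;
  rewrite cat_compf1.
Qed.
Next Obligation.
by move=> A X w x y z h g f; apply: functional_extensionality_dep => a /=;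
  rewrite cat_compA.
Qed.

Program Definition prodF (A : Type) (X W : A -> category)
    (F : forall a, functor (X a) (W a)) : functor (prodC X) (prodC W) :=
  {| fob := fun (x : prodC X) a => F a (x a);
     fhom := fun _ _ f a => fhom (F a) (f a) |}.
Next Obligation.
by move=> A X W F x; apply: functional_extensionality_dep => a /=;
  rewrite fhom_id.
Qed.
Next Obligation.
by move=> A X W F x y z g f; apply: functional_extensionality_dep => a /=;
  rewrite fhom_comp.
Qed.

Record decomposition (C : category) (A : Type) (X : A -> category) :=
  Decomposition {
    decomp_iso :> isomorphism C (prodC X);
    decomp_loop_free : forall a, loop_free (X a) }.

Program Definition swapF (A B : Type) (Z : A -> B -> category) :
    functor (prodC (fun a => prodC (fun b => Z a b)))
            (prodC (fun b => prodC (fun a => Z a b))) :=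
  {| fob := fun (z : prodC (fun a => prodC (fun b => Z a b))) b a => z a b;
     fhom := fun _ _ f b a => f a b |}.

Lemma swapFK (A B : Type) (Z : A -> B -> category) :
  compF (swapF (fun b a => Z a b)) (swapF Z) = idF _.
Proof. rewrite /compF /idF; congr Functor; exact: Prop_irrelevance. Qed.

Definition swapI (A B : Type) (Z : A -> B -> category) :
    isomorphism (prodC (fun a => prodC (fun b => Z a b)))
                (prodC (fun b => prodC (fun a => Z a b))) :=
  {| iso_fun := swapF Z;
     iso_inv := swapF (fun b a => Z a b);
     iso_funK := swapFK Z;
     iso_invK := swapFK (fun b a => Z a b) |}.

(* Main.v *)
Require Import Defs.
From mathcomp Require Import all_boot.
From mathcomp Require Import boolp.

Set Implicit Arguments.
Unset Strict Implicit.
Unset Printing Implicit Defensive.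

(** If [C] has an object [e], a coordinate of a decomposition of [C] gives an
    idempotent functor [P : C -> C] that keeps this coordinate and replaces all
    the others by those of [e]. Write [P a] and [Q b] for the functors obtained
    from the two decompositions. The heart of the matter is that [P a] and
    [Q b] commute; then [Z a b] is the full subcategory of the objects fixed by
    both of them.

    To see that they commute, order the morphisms of [C] by [f <= g] when there
    is a commutative square from [f] to [g]. Loop-freeness makes this a partial
    order, and it is connected when [C] is. A coordinate of a decomposition
    amounts to a monotone operation [f x y], "the given coordinate of [x] and
    the other coordinates of [y]". Two such operations [f], [g] commute at [x]
    and [e] when [x <= e]: from [f x e <= g (f x e) e <= e], antisymmetry shows
    that [g _ e] does not disturb the coordinates that [f _ e] has reset. This
    propagates along fences to the whole order.

    If [C] is empty, some [X a0] and some [Y b0] are empty, and one may put the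
    empty category at [(a0, b0)], the other [X a] in the column [b0], the other
    [Y b] in the row [a0], and the terminal category elsewhere. *)

#[local] Obligation Tactic := try by [].

(** * Decomposition operations on a connected order *)

Section DecompositionOperations.

Variables (M : Type) (le : M -> M -> Prop).

(** These are the monotone rectangular bands: they encode a splitting of the order into two factors
    without naming the factors. *)
Record decomp_op (f : M -> M -> M) : Prop := DecompOp {
  decomp_opxx : forall x, f x x = x;
  decomp_opl : forall x y z, f (f x y) z = f x z;
  decomp_opr : forall x y z, f x (f y z) = f x z;
  decomp_op_mono : forall x x' y y',
    le x x' -> le y y' -> le (f x y) (f x' y') }.

Hypothesis le_refl : forall x, le x x.
Hypothesis le_anti : forall x y, le x y -> le y x -> x = y.
Hypothesis le_connected : forall S : M -> Prop,
  (forall x y, le x y -> (S x <-> S y)) -> forall x y, S x -> S y.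

Lemma decomp_op_flip f : decomp_op f -> decomp_op (fun x y => f y x).
Proof. by case=> fxx fl fr fm; split=> // *; apply: fm. Qed.

Lemma decomp_op_stable_below f g x e : decomp_op f -> decomp_op g ->
  le x e -> f (g (f x e) e) e = g (f x e) e.
Proof.
move=> [fxx fl fr fm] [gxx _ _ gm] xe; set u := f x e.
have ue : le u e by rewrite -[e in le _ e]fxx; apply: fm.
have uq : le u (g u e) by rewrite -{1}(gxx u); apply: gm.
have qe : le (g u e) e by rewrite -[e in le _ e]gxx; apply: gm.
(* The squeeze is [e = f e u <= f e (g u e) <= f e e = e]. *)
have feq : f e (g u e) = e.
  apply: le_anti; first by rewrite -[e in le _ e]fxx; apply: fm.
  have {1}-> : e = f e u by rewrite /u fr fxx.
  exact: fm.
by rewrite -{2}feq fr fxx.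
Qed.

Lemma decomp_op_comm_below f g x e : decomp_op f -> decomp_op g ->
  le x e -> f (g x e) e = g (f x e) e.
Proof.
move=> df dg xe.
(* Stability turns the right-hand side into [h (k (h x e) e) e], so [x <= h x e] and monotonicity
   suffice. *)
have half h k : decomp_op h -> decomp_op k -> le (h (k x e) e) (k (h x e) e).
  move=> dh dk; rewrite -(decomp_op_stable_below dh dk xe).
  have [hxx _ _ hm] := dh; have [_ _ _ km] := dk.
  by apply: (hm) => //; apply: km => //; rewrite -{1}(hxx x); apply: hm.
by apply: le_anti; [apply: (half f g) | apply: (half g f)].
Qed.

(* [f u w = w] says that [u] and [w] have the same first [f]-coordinate, and
   [g u w = u] that they have the same second [g]-coordinate. *)
Lemma decomp_op_translate f g u w t : decomp_op f -> decomp_op g ->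
  le w u -> g u w = u -> f u w = w -> f (g u t) (g w t) = g w t.
Proof.
move=> df dg wu guw fuw.
have [fxx fl fr fm] := df; have [gxx gl gr gm] := dg.
(* At [t = u] the claim reads [f u w = w]; connectedness carries it to every [t]. *)
suff step s r : le r s ->
    (f (g u r) (g w r) = g w r <-> f (g u s) (g w s) = g w s).
  pose S r := f (g u r) (g w r) = g w r.
  apply: (le_connected (S := S) _ (x := u)) => [r s|]; first exact: step.
  have wu_eq : g w u = w by rewrite -{1}guw gr gxx.
  by rewrite /S gxx wu_eq.
(* Since [g x m = g w s] and [g m x = g u r], commuting [f] with [g] and with its flip on the pair
   [x <= m] relates the claims at [r] and [s]. *)
move=> rs; set m := g u s; set x := g w r.
have xm : le x m by apply: gm.
have E1 : f (g w s) m = g (f x m) m.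
  by rewrite -(decomp_op_comm_below df dg xm) /x /m gl gr.
have E2 : f (g u r) m = g m (f x m).
  by rewrite -(decomp_op_comm_below df (decomp_op_flip dg) xm) /x /m gl gr.
split=> H.
- have E3 : g m (f x m) = f x m by rewrite -E2 -H fl.
  have E4 : f (g w s) m = m by rewrite E1 -E3 gl gxx.
  by rewrite -{1}E4 fl fxx.
- have E3 : g (f x m) m = m by rewrite -E1 -H fl fxx.
  have E4 : f (g u r) m = f x m by rewrite E2 -{1}E3 gl gxx.
  have := congr1 (fun z => f z x) E4.
  by rewrite !fl fxx.
Qed.

Lemma decomp_op_preserve f g u v e : decomp_op f -> decomp_op g ->
  f u v = v -> f (g u e) (g v e) = g v e.
Proof.
move=> df dg fuv.
have [fxx fl fr fm] := df; have [gxx gl gr gm] := dg.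
(* Replacing [a] by [g a b] does not change [g a e], and gives a point with the second
   [g]-coordinate of [b], as the translation lemma requires. *)
have down a b : le a b -> f b a = a -> f (g b e) (g a e) = g a e.
  move=> ab fba; rewrite -(gl a b e).
  apply: decomp_op_translate => //.
  - by rewrite -{2}(gxx b); apply: gm.
  - by rewrite gr gxx.
  - by rewrite (decomp_op_comm_below (decomp_op_flip df) dg ab) fba.
(* All points [f u t] share the first [f]-coordinate of [u]; moving [t] from [u] to [v] reaches
   [f u v = v] through comparable points. *)
pose S t := f (g u e) (g (f u t) e) = g (f u t) e.
suff : S v by rewrite /S fuv.
apply: (le_connected (S := S) _ (x := u)) => [s t st|]; last by rewrite /S !fxx.
have E : f (g (f u t) e) (g (f u s) e) = g (f u s) e.
  by apply: down; [apply: fm | rewrite fl fr].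
rewrite /S; move: E.
set a := g (f u t) e; set b := g (f u s) e; set c := g u e => E.
split=> H; last by rewrite -{2}E -H fl.
by rewrite -{2}(fxx a) -(fl a b) E -H fl.
Qed.

(** The point [f x e] shares its first [f]-coordinate with [x] and its second with [e]. As [g _ e]
    preserves both relations and fixes [e], the right-hand side has the [f]-coordinates of the
    left-hand side. *)
Lemma decomp_op_comm f g x e : decomp_op f -> decomp_op g ->
  f (g x e) e = g (f x e) e.
Proof.
move=> df dg.
have [fxx fl fr fm] := df; have [gxx gl gr gm] := dg.
have E1 : f (g x e) (g (f x e) e) = g (f x e) e.
  by apply: decomp_op_preserve => //; rewrite fr.
have E2 : f (g (f x e) e) e = g (f x e) e.
  have := decomp_op_preserve (u := e) (v := f x e) e (decomp_op_flip df) dg.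
  by rewrite fl gxx; apply.
by rewrite -E2 -E1 fl.
Qed.

End DecompositionOperations.

(** * Categories through their morphisms *)

(** Equations are stated in [mor C] to avoid transports along equal endpoints; proof irrelevance
    brings them back to a hom-set. *)
Lemma Mor_inj (C : category) (x y : C) : injective (@Mor C x y).
Proof.
have arrow_eq (m m' : mor C) (e : m = m') (d : dom m = dom m')
    (c : cod m = cod m') :
    eq_rect _ (hom _) (eq_rect _ (fun x => hom x _) (arrow m) _ d) _ c
    = arrow m'.
  by case: _ / e d c => d c;
    rewrite (Prop_irrelevance d erefl) (Prop_irrelevance c erefl).
by move=> f g e; have /= -> := arrow_eq _ _ e erefl erefl.
Qed.

Definition id_mor (C : category) (x : C) : mor C := Mor (cat_id x).

Lemma is_identityP (C : category) (x y : C) (f : hom x y) :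
  is_identity f <-> Mor f = id_mor x.
Proof.
split=> [[]//|e].
suff gen (m : mor C) : m = id_mor x -> is_identity (arrow m) by exact: gen e.
by move=> ->.
Qed.

Section Functors.

Variables C D : category.

Definition fmor (F : functor C D) (m : mor C) : mor D := Mor (fhom F (arrow m)).

Lemma fmor_id F x : fmor F (id_mor x) = Mor (cat_id (F x)).
Proof. by rewrite /fmor /= fhom_id. Qed.

Lemma functor_ext (F G : functor C D) :
  (forall m, fmor F m = fmor G m) -> F = G.
Proof.
case: F G => fo fh fi fc [go gh gi gc] eFG.
have efg : fo = go.
  by apply: funext => x; exact: (congr1 (@dom D) (eFG (id_mor x))).
case: _ / efg in gh gi gc eFG *.
have efg : fh = gh.
  apply: functional_extensionality_dep => x.
  apply: functional_extensionality_dep => y.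
  apply: functional_extensionality_dep => f.
  exact: Mor_inj (eFG (Mor f)).
case: _ / efg in gi gc eFG *.
by congr Functor; exact: Prop_irrelevance.
Qed.

End Functors.

Lemma fmor_ob (C D : category) (F G : functor C D) x :
  (forall m, fmor F m = fmor G m) -> F x = G x.
Proof. by move=> FG; exact: (congr1 (@dom D) (FG (id_mor x))). Qed.

(** * The order on morphisms given by commutative squares *)

Section MorphismOrder.

Variable C : category.

Definition mor_le (f g : mor C) : Prop :=
  exists (h : hom (dom f) (dom g)) (k : hom (cod f) (cod g)),
    cat_comp k (arrow f) = cat_comp (arrow g) h.

Lemma mor_le_refl f : mor_le f f.
Proof.
by exists (cat_id _), (cat_id _); rewrite cat_comp1f cat_compf1.
Qed.

(** Opposite squares give arrows both ways between the domains and between the codomains, so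
    loop-freeness makes their sides identities. *)
Lemma mor_le_anti (hC : loop_free C) f g : mor_le f g -> mor_le g f -> f = g.
Proof.
case: f g => [x y f] [x' y' g] [/= h [k e]] [/= h' [k' _]].
have /contrapT hid : ~ ~ is_identity h by move=> /hC/(_ h').
have /contrapT kid : ~ ~ is_identity k by move=> /hC/(_ k').
destruct kid, hid; move: e.
by rewrite cat_comp1f cat_compf1 => ->.
Qed.

Lemma mor_le_connected (hconn : connected C) (S : mor C -> Prop) :
  (forall f g, mor_le f g -> (S f <-> S g)) -> forall f g, S f -> S g.
Proof.
move=> Sle f g Sf.
(* Each morphism lies below the identity of its codomain and above that of its domain, so [S] passes
   between morphisms sharing a domain or a codomain. *)
have to_cod m : S m <-> S (id_mor (cod m)).
  by apply: Sle; exists (arrow m), (cat_id _).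
have to_dom m : S m <-> S (id_mor (dom m)).
  by symmetry; apply: Sle; exists (cat_id _), (arrow m).
have via_cod m m' : cod m = cod m' -> S m -> S m'.
  by move=> e /(to_cod m).1; rewrite e; exact: (to_cod m').2.
have via_dom m m' : dom m = dom m' -> S m -> S m'.
  by move=> e /(to_dom m).1; rewrite e; exact: (to_dom m').2.
have [n [s [n_gt0 sF s1 sn]]] := hconn f g.
suff Ss i : i < n -> S (s i.+1) by rewrite -sn -(prednK n_gt0);
  apply: Ss; rewrite prednK.
elim: i => [|i IHi] lin; first by rewrite s1.
have {IHi} Si := IHi (ltnW lin).
(* The fence condition at [k] links members [2k-1, 2k] and members [2k, 2k+1]; parity selects the
   link between [i+1] and [i+2]. *)
have [k [k_gt0 [ei|ei]]] : exists k, 0 < k /\ (i.+1 = 2 * k \/ i.+2 = 2 * k).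
  exists (i.+2)./2; split=> //.
  rewrite mul2n; have := odd_double_half i.+2.
  case: (odd i.+2) => e; last by right; exact: esym e.
  by left; apply: succn_inj; exact: esym e.
- by case: sF => /(_ k k_gt0) [+ _]; rewrite -ei => /(_ lin) e;
    move: Si; [apply: via_cod | apply: via_dom].
- by case: sF => /(_ k k_gt0) [_ +]; rewrite -ei => /(_ lin) e;
    move: Si; [apply: via_dom | apply: via_cod].
Qed.

End MorphismOrder.

Lemma fmor_le (C D : category) (F : functor C D) f g :
  mor_le f g -> mor_le (fmor F f) (fmor F g).
Proof.
by case=> h [k e]; exists (fhom F h), (fhom F k); rewrite /= -!fhom_comp e.
Qed.

Lemma loop_free_endo (C : category) (hC : loop_free C) (m : mor C) :
  dom m = cod m -> m = id_mor (dom m).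
Proof.
case: m => x y f /= e; case: _ / e in f *.
have /contrapT fid : ~ ~ is_identity f by move=> /hC/(_ f).
exact/is_identityP.
Qed.

Section Isomorphisms.

Variables (C D : category) (F : isomorphism C D).

Lemma fmor_isoK m : fmor (iso_inv F) (fmor F m) = m.
Proof.
by have := congr1 (fun G => fmor G m) (iso_funK F); case: m.
Qed.

Lemma fmor_isoVK m : fmor F (fmor (iso_inv F) m) = m.
Proof.
by have := congr1 (fun G => fmor G m) (iso_invK F); case: m.
Qed.

End Isomorphisms.

Lemma isomorphism_of_fmor (C D : category) (F : functor C D)
    (G : functor D C) :
  (forall m, fmor G (fmor F m) = m) -> (forall m, fmor F (fmor G m) = m) ->
  exists I : isomorphism C D, iso_fun I = F.
Proof.
move=> FK GK.
have FK' : compF G F = idF C.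
  by apply: functor_ext => m; move: (FK m); case: m.
have GK' : compF F G = idF D.
  by apply: functor_ext => m; move: (GK m); case: m.
by exists (Isomorphism FK' GK').
Qed.

Section Products.

Variables (A : Type) (X : A -> category).

Program Definition projF (a : A) : functor (prodC X) (X a) :=
  {| fob := fun x : prodC X => x a; fhom := fun _ _ f => f a |}.

Program Definition tupleF (D : category) (F : forall a, functor D (X a)) :
    functor D (prodC X) :=
  {| fob := fun x a => F a x; fhom := fun _ _ f a => fhom (F a) f |}.
Next Obligation.
by move=> D F x; apply: functional_extensionality_dep => a; rewrite fhom_id.
Qed.
Next Obligation.
move=> D F x y z g f.
by apply: functional_extensionality_dep => a; rewrite fhom_comp.
Qed.

Definition tuple_mor (m : forall a, mor (X a)) : mor (prodC X) :=
  @Mor (prodC X) (fun a => dom (m a)) (fun a => cod (m a)) (fun a => arrow (m a)).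

Lemma proj_tuple_mor m a : fmor (projF a) (tuple_mor m) = m a.
Proof. by rewrite /fmor /=; case: (m a). Qed.

Lemma prod_mor_ext (m m' : mor (prodC X)) :
  (forall a, fmor (projF a) m = fmor (projF a) m') -> m = m'.
Proof.
move=> e; have K n : tuple_mor (fun a => fmor (projF a) n) = n by case: n.
by rewrite -(K m) -(K m'); congr tuple_mor; apply: functional_extensionality_dep.
Qed.

Lemma prod_mor_le (m m' : mor (prodC X)) :
  (forall a, mor_le (fmor (projF a) m) (fmor (projF a) m')) -> mor_le m m'.
Proof.
move=> le_a.
exists (fun a => sval (cid (le_a a))), (fun a => sval (cid (svalP (cid (le_a a))))).
by apply: functional_extensionality_dep => a; exact: svalP (cid (svalP (cid (le_a a)))).
Qed.

End Products.

Program Definition constF (C D : category) (d : D) : functor C D :=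
  {| fob := fun _ => d; fhom := fun _ _ _ => cat_id d |}.
Next Obligation. by move=> C D d x y z g f; rewrite cat_comp1f. Qed.

Section FullSubcategories.

Variables (C : category) (S : C -> Prop).

Program Definition fullC : category :=
  {| ob := {x : C | S x};
     hom := fun x y => hom (sval x) (sval y);
     cat_id := fun x => cat_id (sval x);
     cat_comp := fun _ _ _ g f => cat_comp g f |}.
Next Obligation. by move=> x y f; exact: cat_comp1f. Qed.
Next Obligation. by move=> x y f; exact: cat_compf1. Qed.
Next Obligation. by move=> w x y z h g f; exact: cat_compA. Qed.

Program Definition inclF : functor fullC C :=
  {| fob := fun x : fullC => sval x; fhom := fun _ _ f => f |}.

Program Definition corestrictF (D : category) (F : functor D C)
    (FS : forall x, S (F x)) : functor D fullC :=
  {| fob := fun x => exist S (F x) (FS x) : fullC;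
     fhom := fun _ _ f => fhom F f |}.
Next Obligation. by move=> D F FS x; exact: fhom_id. Qed.
Next Obligation. by move=> D F FS x y z g f; exact: fhom_comp. Qed.

Lemma fmor_inclF_inj : injective (fmor inclF).
Proof.
have gen (m m' : mor C) (e : m = m') px py px' py' :
    @Mor fullC (exist S (dom m) px) (exist S (cod m) py) (arrow m) =
    @Mor fullC (exist S (dom m') px') (exist S (cod m') py') (arrow m').
  case: _ / e in px' py' *.
  by rewrite (Prop_irrelevance px' px) (Prop_irrelevance py' py).
by move=> [[x px] [y py] f] [[x' px'] [y' py'] f'] e;
  exact: (gen _ _ e px py px' py').
Qed.

Lemma loop_free_full : loop_free C -> loop_free fullC.
Proof.
move=> hC x y f fN; apply: (hC (sval x) (sval y) f) => fid; apply: fN.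
apply/is_identityP; apply: fmor_inclF_inj.
exact: (is_identityP _).1 fid.
Qed.

End FullSubcategories.

(** * Coordinates and slices of a decomposition *)

Section Coordinates.

Variables (C : category) (A : Type) (X : A -> category).
Variable Psi : isomorphism C (prodC X).

Definition coordF (a : A) : functor C (X a) := compF (projF X a) Psi.

Definition assembleF (D : category) (F : forall a, functor D (X a)) :
  functor D C := compF (iso_inv Psi) (tupleF F).

Lemma coord_ext m m' :
  (forall a, fmor (coordF a) m = fmor (coordF a) m') -> m = m'.
Proof.
move=> e; rewrite -(fmor_isoK Psi m) -(fmor_isoK Psi m').
by congr fmor; apply: prod_mor_ext => a; apply: e.
Qed.

Lemma coord_le m m' :
  (forall a, mor_le (fmor (coordF a) m) (fmor (coordF a) m')) -> mor_le m m'.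
Proof.
move=> e; rewrite -(fmor_isoK Psi m) -(fmor_isoK Psi m').
by apply: fmor_le; apply: prod_mor_le => a; apply: e.
Qed.

Lemma coord_assemble (D : category) (F : forall a, functor D (X a)) a m :
  fmor (coordF a) (fmor (assembleF F) m) = fmor (F a) m.
Proof.
exact: (congr1 (fmor (projF X a)) (fmor_isoVK Psi (fmor (tupleF F) m))).
Qed.

Definition mix (a : A) (m n : mor C) : mor C :=
  fmor (iso_inv Psi) (tuple_mor (fun a' =>
    if pselect (a = a') then fmor (coordF a') m else fmor (coordF a') n)).

Lemma coord_mix a a' m n : fmor (coordF a') (mix a m n) =
  if pselect (a = a') then fmor (coordF a') m else fmor (coordF a') n.
Proof.
rewrite -[LHS]/(fmor (projF X a') (fmor Psi (mix a m n))) fmor_isoVK.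
by rewrite proj_tuple_mor.
Qed.

Lemma mix_decomp_op a : decomp_op (@mor_le C) (mix a).
Proof.
split=> *; first [apply: coord_ext | apply: coord_le] => a';
  rewrite !coord_mix; case: pselect => //= _; exact: fmor_le.
Qed.

Variable e : C.

Definition axisF (a a' : A) : functor (X a) (X a') :=
  match pselect (a = a') with
  | left aa' => eq_rect a (fun a' => functor (X a) (X a')) (idF (X a)) a' aa'
  | right _ => constF (X a) (coordF a' e)
  end.

Definition insertF (a : A) : functor (X a) C := assembleF (axisF a).

Definition sliceF (a : A) : functor C C := compF (insertF a) (coordF a).

Lemma fmor_axis_diag a m : fmor (axisF a a) m = m.
Proof.
rewrite /axisF; case: pselect => // aa.
by rewrite (Prop_irrelevance aa erefl); case: m.
Qed.

Lemma fmor_axis a a' m :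
  a <> a' -> fmor (axisF a a') m = fmor (coordF a') (id_mor e).
Proof. by rewrite fmor_id /axisF; case: pselect. Qed.

Lemma coord_insert a m : fmor (coordF a) (fmor (insertF a) m) = m.
Proof. by rewrite coord_assemble fmor_axis_diag. Qed.

(** This bridges the functor used to build the refinement and the decomposition operation to which
    the commutation result applies. *)
Lemma slice_mix a m : fmor (sliceF a) m = mix a m (id_mor e).
Proof.
apply: coord_ext => a'; rewrite coord_mix.
rewrite -[fmor (sliceF a) m]/(fmor (assembleF (axisF a)) (fmor (coordF a) m)).
rewrite coord_assemble; case: pselect => [aa'|]; last exact: fmor_axis.
by case: _ / aa'; exact: fmor_axis_diag.
Qed.

Lemma slice_insert a m : fmor (sliceF a) (fmor (insertF a) m) = fmor (insertF a) m.
Proof.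
exact: (congr1 (fmor (insertF a)) (coord_insert m)).
Qed.

Lemma coord_slice a m : fmor (coordF a) (fmor (sliceF a) m) = fmor (coordF a) m.
Proof. exact: (coord_insert (fmor (coordF a) m)). Qed.

Lemma slice_idem a m : fmor (sliceF a) (fmor (sliceF a) m) = fmor (sliceF a) m.
Proof. exact: (slice_insert (fmor (coordF a) m)). Qed.

(* Away from the coordinate [a], both endpoints are those of [e], and loop-free
   categories have no endomorphisms but identities. *)
Lemma fmor_slice_fixed (hX : forall a, loop_free (X a)) a m :
  sliceF a (dom m) = dom m -> sliceF a (cod m) = cod m -> fmor (sliceF a) m = m.
Proof.
move=> dm cm; apply: coord_ext => a'.
rewrite slice_mix coord_mix; case: pselect => // aa'.
have fixE x : sliceF a x = x -> coordF a' x = coordF a' e.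
  move=> {1}<-.
  have := congr1 (@dom _) (congr1 (fmor (coordF a')) (slice_mix a (id_mor x))).
  by rewrite coord_mix; case: pselect.
have dE : dom (fmor (coordF a') m) = coordF a' e := fixE _ dm.
have cE : cod (fmor (coordF a') m) = coordF a' e := fixE _ cm.
by rewrite fmor_id -dE; apply/esym/loop_free_endo; rewrite ?dE.
Qed.

End Coordinates.

Lemma slice_comm (C : category) (hC : loop_free C) (hconn : connected C)
    (A B : Type) (X : A -> category) (Y : B -> category)
    (PsiA : isomorphism C (prodC X)) (PsiB : isomorphism C (prodC Y))
    (e : C) a b m :
  fmor (sliceF PsiA e a) (fmor (sliceF PsiB e b) m) =
  fmor (sliceF PsiB e b) (fmor (sliceF PsiA e a) m).
Proof.
rewrite !slice_mix; apply: decomp_op_comm.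
- exact: mor_le_refl.
- exact: mor_le_anti.
- exact: mor_le_connected.
- exact: mix_decomp_op.
- exact: mix_decomp_op.
Qed.

(** * Refining one factor when the slices commute *)

Section Refinement.

Variables (C : category) (A B : Type) (X : A -> category) (Y : B -> category).
Variables (PsiA : isomorphism C (prodC X)) (PsiB : isomorphism C (prodC Y)).
Hypothesis hX : forall a, loop_free (X a).
Hypothesis hY : forall b, loop_free (Y b).
Variable e : C.

Local Notation P := (sliceF PsiA e).
Local Notation Q := (sliceF PsiB e).

Hypothesis PQ : forall a b m,
  fmor (P a) (fmor (Q b) m) = fmor (Q b) (fmor (P a) m).

(** An object of [X a] is placed on the axis through [e] and sliced by every [Q b]. As [S] is only
    characterised up to equivalence, exchanging the two decompositions yields the same
    subcategories. *)
Lemma axis_refinement (a : A) (S : B -> C -> Prop) :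
  (forall b x, S b x <-> P a x = x /\ Q b x = x) ->
  exists I : isomorphism (X a) (prodC (fun b => fullC (S b))),
    forall b m, fmor (inclF (S b)) (fmor (projF _ b) (fmor I m)) =
      fmor (Q b) (fmor (insertF PsiA e a) m).
Proof.
move=> SP.
have QS b x : S b (compF (Q b) (insertF PsiA e a) x).
  apply/SP; split.
  - apply: (fmor_ob (F := compF (P a) (compF (Q b) (insertF PsiA e a)))
      (G := compF (Q b) (insertF PsiA e a))) => m.
    rewrite -[LHS]/(fmor (P a) (fmor (Q b) (fmor (insertF PsiA e a) m))).
    by rewrite PQ slice_insert.
  - apply: (fmor_ob (F := compF (Q b) (compF (Q b) (insertF PsiA e a)))
      (G := compF (Q b) (insertF PsiA e a))) => m.
    exact: (slice_idem PsiB e b (fmor (insertF PsiA e a) m)).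
pose F : functor (X a) (prodC (fun b => fullC (S b))) :=
  tupleF (fun b => corestrictF (QS b)).
(* For the inverse, [w] takes the [b]-th [Y]-coordinate from the [b]-th component; its
   [a]-coordinate is then extracted. *)
pose w : functor (prodC (fun b => fullC (S b))) C :=
  assembleF PsiB (fun b => compF (coordF PsiB b) (compF (inclF (S b)) (projF _ b))).
pose G := compF (coordF PsiA a) w.
have FE b m : fmor (inclF (S b)) (fmor (projF _ b) (fmor F m)) =
    fmor (Q b) (fmor (insertF PsiA e a) m) by [].
have wE b m : fmor (coordF PsiB b) (fmor w m) =
    fmor (coordF PsiB b) (fmor (inclF (S b)) (fmor (projF _ b) m)).
  exact: coord_assemble.
have [| |I IF] := @isomorphism_of_fmor _ _ F G.
- move=> m; rewrite -[LHS]/(fmor (coordF PsiA a) (fmor w (fmor F m))).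
  rewrite -[RHS](coord_insert PsiA e m); congr fmor.
  by apply: (coord_ext (Psi := PsiB)) => b; rewrite wE FE coord_slice.
- move=> m; apply: prod_mor_ext => b; apply: fmor_inclF_inj.
  rewrite FE; set z := fmor (inclF (S b)) _.
  (* The chain is [Q b (P a w) = P a (Q b w) = P a (Q b z) = z], the last step because both slices
     fix the endpoints of [z]. *)
  rewrite -[fmor (insertF _ _ _) _]/(fmor (P a) (fmor w m)) -PQ.
  have -> : fmor (Q b) (fmor w m) = fmor (Q b) z.
    exact: (congr1 (fmor (insertF PsiB e b)) (wE b m)).
  have [Pd Qd] := (SP b _).1 (svalP (dom m b)).
  have [Pc Qc] := (SP b _).1 (svalP (cod m b)).
  rewrite (fmor_slice_fixed (m := z) hY Qd Qc).
  exact: (fmor_slice_fixed (m := z) hX Pd Pc).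
- by exists I => b m; rewrite IF.
Qed.

End Refinement.

(** * The empty category *)

Program Definition discreteC (T : Type) : category :=
  {| ob := T; hom := fun x y => x = y;
     cat_id := fun x => erefl x;
     cat_comp := fun _ _ _ yz xy => etrans xy yz |}.

Lemma loop_free_discrete T : loop_free (discreteC T).
Proof. by move=> x y f fN _; apply: fN; case: _ / f; exact: IsIdentity. Qed.

Lemma empty_isomorphism (C D : category) :
  (C -> False) -> (D -> False) -> inhabited (isomorphism C D).
Proof.
move=> C0 D0.
have emptyF (E E' : category) : (E -> False) -> inhabited (functor E E').
  move=> E0; have any T : E -> T by move=> x; case: (E0 x).
  by exists; exists (any E') (fun x _ _ => any _ x) => x; case: (E0 x).
have [F] := emptyF C D C0; have [G] := emptyF D C D0.
have [| |I _] := @isomorphism_of_fmor _ _ F G; last by exists.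
- by move=> m; case: (C0 (dom m)).
- by move=> m; case: (D0 (dom m)).
Qed.

Lemma one_factor_isomorphism (A : Type) (Z : A -> category) (a : A) :
  (forall a', a <> a' -> exists x : Z a', forall m, m = id_mor x) ->
  inhabited (isomorphism (Z a) (prodC Z)).
Proof.
move=> triv.
have [[x]|Za0] := pselect (inhabited (Z a)); last first.
  by apply: empty_isomorphism => [x|z]; apply: Za0; [exists | exists; exact: z a].
pose e : prodC Z := fun a' =>
  match pselect (a = a') with
  | left aa' => eq_rect a Z x a' aa'
  | right na => sval (cid (triv a' na))
  end.
(* Viewing the identity as a decomposition of the product makes insertion along the axis through [e]
   available as inverse of the projection. *)
have [| |idI _] := @isomorphism_of_fmor _ _ (idF (prodC Z)) (idF (prodC Z)).
- by case.
- by case.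
have [| |I _] := @isomorphism_of_fmor _ _ (insertF idI e a) (coordF idI a);
  last by exists.
- exact: coord_insert.
- move=> m; apply: (coord_ext (Psi := idI)) => a'.
  have [aa'|naa'] := pselect (a = a').
    by case: _ / aa'; rewrite coord_insert.
  have [y yP] := triv a' naa'.
  by rewrite (yP (fmor _ m)) (yP (fmor _ _)).
Qed.

Lemma empty_factor (A : Type) (X : A -> category) :
  (prodC X -> False) -> exists a, X a -> False.
Proof.
move=> X0; apply: contrapT => nex; apply: X0 => a.
suff /cid[x _] : exists x : X a, True by exact: x.
by apply: contrapT => Xa; apply: nex; exists a => x; apply: Xa; exists x.
Qed.

(** Compatibility with the swap is left out: functors from an empty category are all equal. *)
Lemma empty_refinement (C : category) (A B : Type) (X : A -> category)
    (Y : B -> category) (PsiA : decomposition C X) (PsiB : decomposition C Y) :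
  (C -> False) ->
  exists (Z : A -> B -> category)
    (a : forall alpha, isomorphism (X alpha) (prodC (fun beta => Z alpha beta)))
    (b : forall beta, isomorphism (Y beta) (prodC (fun alpha => Z alpha beta))),
    (forall alpha beta, loop_free (Z alpha beta)).
Proof.
move=> C0.
have [a0 Xa0] : exists a, X a -> False.
  by apply: empty_factor => x; apply: C0; exact: iso_inv PsiA x.
have [b0 Yb0] : exists b, Y b -> False.
  by apply: empty_factor => y; apply: C0; exact: iso_inv PsiB y.
pose Z a b := if pselect (a = a0)
  then if pselect (b = b0) then discreteC void else Y b
  else if pselect (b = b0) then X a else discreteC unit.
have Z00 : Z a0 b0 = discreteC void by rewrite /Z; do 2!case: pselect.
have ZX a : a <> a0 -> Z a b0 = X a by rewrite /Z; do 2!case: pselect.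
have ZY b : b <> b0 -> Z a0 b = Y b by rewrite /Z; do 2!case: pselect.
have Z1 a b : a <> a0 -> b <> b0 -> Z a b = discreteC unit.
  by rewrite /Z; do 2!case: pselect.
have unit_trivial : exists x : discreteC unit, forall m, m = id_mor x.
  by exists tt; case=> -[] [] f; congr Mor; exact: (@Prop_irrelevance (tt = tt)).
have isoX a : inhabited (isomorphism (X a) (prodC (fun b => Z a b))).
  have [->|na] := pselect (a = a0).
    apply: empty_isomorphism => // z; have := z b0.
    by rewrite /= Z00; case.
  have [|I] := @one_factor_isomorphism B (Z a) b0; last by rewrite -ZX.
  by move=> b nb; rewrite Z1 // => bb; apply: nb.
have isoY b : inhabited (isomorphism (Y b) (prodC (fun a => Z a b))).
  have [->|nb] := pselect (b = b0).
    apply: empty_isomorphism => // z; have := z a0.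
    by rewrite /= Z00; case.
  have [|I] := @one_factor_isomorphism A (fun a => Z a b) a0; last by rewrite -ZY.
  by move=> a na; rewrite Z1 // => aa; apply: na.
have pick T : inhabited T -> T.
  by move=> iT; have /cid[] : exists x : T, True by case: iT => x; exists x.
exists Z, (fun a => pick _ (isoX a)), (fun b => pick _ (isoY b)) => a b.
rewrite /Z; do 2!case: pselect => ? /=; try exact: loop_free_discrete.
- exact: decomp_loop_free PsiB b.
- exact: decomp_loop_free PsiA a.
Qed.

(** * The refinement theorem *)

Theorem theorem1 (C : category) (hC : loop_free C) (hconn : connected C)
    (A B : Type) (X : A -> category) (Y : B -> category)
    (PsiA : decomposition C X) (PsiB : decomposition C Y) :
  exists (Z : A -> B -> category)
    (a : forall alpha, decomposition (X alpha) (fun beta => Z alpha beta))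
    (b : forall beta, decomposition (Y beta) (fun alpha => Z alpha beta)),
    (forall alpha beta, loop_free (Z alpha beta)) /\
    compF (prodF (fun beta => b beta)) (compF PsiB (iso_inv PsiA)) =
    compF (swapI Z) (prodF (fun alpha => a alpha)).
Proof.
have [[e]|C0] := pselect (inhabited C); last first.
  have {}C0 : C -> False by move=> x; apply: C0; exists.
  have [Z [a [b hZ]]] := empty_refinement PsiA PsiB C0.
  exists Z, (fun al => Decomposition (a al) (fun be => hZ al be)),
    (fun be => Decomposition (b be) (fun al => hZ al be)).
  by split=> //; apply: functor_ext => m; case: (C0 (iso_inv PsiA (dom m))).
have hX := decomp_loop_free PsiA; have hY := decomp_loop_free PsiB.
have PQ al be m := slice_comm hC hconn PsiA PsiB e al be m.
pose S al be x := sliceF PsiA e al x = x /\ sliceF PsiB e be x = x.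
have exa al := axis_refinement hX hY PQ (a := al) (S := S al) (fun _ _ => iff_refl _).
have exb be := axis_refinement hY hX (fun be al m => esym (PQ al be m)) (a := be)
  (S := fun al => S al be) (fun _ _ => and_comm _ _).
have hZ al be : loop_free (fullC (S al be)) by exact: loop_free_full.
pose a al := Decomposition (sval (cid (exa al))) (fun be => hZ al be).
pose b be := Decomposition (sval (cid (exb be))) (fun al => hZ al be).
have aE al be m : fmor (inclF (S al be)) (fmor (projF _ be) (fmor (a al) m)) =
    fmor (sliceF PsiB e be) (fmor (insertF PsiA e al) m).
  exact: (svalP (cid (exa al))).
have bE al be m : fmor (inclF (S al be)) (fmor (projF _ al) (fmor (b be) m)) =
    fmor (sliceF PsiA e al) (fmor (insertF PsiB e be) m).
  exact: (svalP (cid (exb be))).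
exists (fun al be => fullC (S al be)), a, b; split=> //.
apply: functor_ext => m; pose c := fmor (iso_inv PsiA) m.
apply: prod_mor_ext => be; apply: prod_mor_ext => al; apply: fmor_inclF_inj.
(* The two sides have components [P al (Q be c)] and [Q be (P al c)], with [P] and [Q] the slices of
   [PsiA] and [PsiB]. *)
transitivity (fmor (sliceF PsiA e al) (fmor (sliceF PsiB e be) c)).
  exact: (bE al be (fmor (coordF PsiB be) c)).
rewrite PQ; symmetry.
have := aE al be (fmor (projF _ al) m).
rewrite -{2}(fmor_isoVK PsiA m).
exact: id.
Qed.
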